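(* Let $R(t)$ be a power series not involving $x$. Then there is a unique power series $f=f(x)$ such that $f(x)=xR(f(x))$, and for any Laurent series $\phi(t)$ and $\psi(t)$ not involving $x$ and any integer $n$ we have \begin{gather*} [x^n]\,\phi(f)=\frac{1}{n}[t^{n-1}]\,\phi'(t)R(t)^n,\quad\text{where } n\neq 0,\\ [x^n]\,\phi(f)=[t^n]\,\bigl(1-tR'(t)/R(t)\bigr)\phi(t)R(t)^n,\\ \phi(f)=\sum_{n} x^n\,[t^n]\,\bigl(1-xR'(t)\bigr)\phi(t)R(t)^n,\\ [x^n]\,\frac{\psi(f)}{1-xR'(f)}=[t^n]\,\psi(t)R(t)^n,\\ [x^n]\,\frac{\psi(f)}{1-fR'(f)/R(f)}=[t^n]\,\psi(t)R(t)^n, \end{gather*} where the sum in the third formula is over all integers $n$.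
   Context: All series are formal, with coefficients in an integral domain $C$ containing the rational numbers. A power series in $t$ is an element $\sum_{n\ge 0}c_nt^n$ of $C[[t]]$, and a Laurent series in $t$ is a formal sum $\sum_{n\ge n_0}c_nt^n$ for some integer $n_0$; similarly for $x$. By convention, if the constant term of $R$ (which is the coefficient of $x$ in $f$) is nonzero, it is taken to be invertible in $C$ (its inverse being adjoined to $C$ if necessary); the constant term of $R$ is allowed to be zero. $[x^n]F(x)$ denotes the coefficient of $x^n$ in the Laurent series $F(x)$, and similarly for $[t^n]$. In the third formula, $[t^n](1-xR'(t))\phi(t)R(t)^n$ is the coefficient of $t^n$ in a series in $t$ whose coefficients may involve $x$. Derivatives are termwise, and $\phi(f)$ denotes the substitution of $f$ for $t$ in $\phi(t)$.
   Formalization: If R(0)=0 then f=0 and the formulas can fail or be undefined (R=t, φ=1, n=0 breaks the second), so there φ, ψ are power series, n≥0 (n>0 in formulas 1, 2), the sum is over n≥0, R is an invertible Laurent series in formula 2, and formula 5 is omitted. *)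

(* Defs.v *)
From HB Require Import structures.
From mathcomp Require Import all_boot all_order all_algebra.
From mathcomp Require Import boolp classical_sets cardinality fsbigop.

Set Implicit Arguments.
Unset Strict Implicit.
Unset Printing Implicit Defensive.

Import Order.TTheory GRing.Theory Num.Theory.
Local Open Scope ring_scope.

Definition bounded_below (R : nmodType) (u : int -> R) : Prop :=
  exists N : int, forall n : int, n < N -> u n = 0.

Record laurent (R : nmodType) := Laurent {
  lcoef :> int -> R;
  lcoef_bounded : bounded_below lcoef
}.

Notation "{ 'laurent' R }" := (laurent R)
  (at level 0, R at level 100, format "{ 'laurent'  R }") : type_scope.

HB.instance Definition _ (R : nmodType) := gen_eqMixin {laurent R}.
HB.instance Definition _ (R : nmodType) := gen_choiceMixin {laurent R}.

Lemma laurentP (R : nmodType) (a b : {laurent R}) : (forall n, a n = b n) -> a = b.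
Proof.
case: a b => [u hu] [v hv] /= /funext uv.
by subst v; congr Laurent; exact: Prop_irrelevance.
Qed.

Lemma bounded_below0 (R : nmodType) : bounded_below (fun _ : int => 0 : R).
Proof. by exists 0. Qed.

(* [laurent_of u] is the series with coefficients [u]; the value 0 is junk,
   returned when [u] is not bounded below. *)
Definition laurent_of (R : nmodType) (u : int -> R) : {laurent R} :=
  if pselect (bounded_below u) is left h then Laurent h
  else Laurent (bounded_below0 R).

Lemma laurent_ofE (R : nmodType) (u : int -> R) n :
  bounded_below u -> laurent_of u n = u n.
Proof. by move=> h; rewrite /laurent_of; case: pselect. Qed.

Section Zmodule.
Variable R : zmodType.
Implicit Types a b c : {laurent R}.

Definition laurent_zero := @Laurent R _ (bounded_below0 R).

Definition laurent_opp a := laurent_of (fun n => - a n).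

Definition laurent_add a b := laurent_of (fun n => a n + b n).

Lemma laurent_oppE a n : laurent_opp a n = - a n.
Proof.
rewrite laurent_ofE //; case: (lcoef_bounded a) => N hN.
by exists N => k kN; rewrite hN ?oppr0.
Qed.

Lemma laurent_addE a b n : laurent_add a b n = a n + b n.
Proof.
rewrite laurent_ofE //.
case: (lcoef_bounded a) (lcoef_bounded b) => N hN [M hM].
exists (Order.min N M) => k; rewrite lt_min => /andP[kN kM].
by rewrite hN ?hM ?addr0.
Qed.

Lemma laurent_addA : associative laurent_add.
Proof. by move=> a b c; apply: laurentP => n; rewrite !laurent_addE addrA. Qed.

Lemma laurent_addC : commutative laurent_add.
Proof. by move=> a b; apply: laurentP => n; rewrite !laurent_addE addrC. Qed.

Lemma laurent_add0 : left_id laurent_zero laurent_add.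
Proof. by move=> a; apply: laurentP => n; rewrite laurent_addE add0r. Qed.

Lemma laurent_addN : left_inverse laurent_zero laurent_opp laurent_add.
Proof.
by move=> a; apply: laurentP => n; rewrite laurent_addE laurent_oppE addNr.
Qed.

HB.instance Definition _ := GRing.isZmodule.Build {laurent R}
  laurent_addA laurent_addC laurent_add0 laurent_addN.

Lemma lcoef0 n : (0 : {laurent R}) n = 0. Proof. by []. Qed.
Lemma lcoefN a n : (- a) n = - a n. Proof. exact: laurent_oppE. Qed.
Lemma lcoefD a b n : (a + b) n = a n + b n. Proof. exact: laurent_addE. Qed.

End Zmodule.

Section ComNzRing.
Variable R : comNzRingType.
Implicit Types a b c : {laurent R}.

Definition laurent_const (c : R) : {laurent R} :=
  laurent_of (fun n => if n == 0 then c else 0).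

Lemma laurent_constE (c : R) n :
  laurent_const c n = if n == 0 then c else 0.
Proof.
rewrite laurent_ofE //; exists 0 => k; rewrite lt_neqAle => /andP[k0 _].
by rewrite (negbTE k0).
Qed.

Definition laurent_mul a b :=
  laurent_of (fun n => \sum_(i \in [set: int]) a i * b (n - i)).

Lemma fsum_seq (u : int -> R) (s : seq int) : uniq s ->
    (forall i, i \notin s -> u i = 0) ->
  \sum_(i \in [set: int]) u i = \sum_(i <- s) u i.
Proof.
move=> us hs; rewrite (@bigfs _ _ _ _ s predT u us) => [|i _]; last exact: hs.
by apply: eq_fsbigl; apply/seteqP; split.
Qed.

Definition window (N M : int) : seq int :=
  [seq N + (k : nat)%:Z | k <- iota 0 (absz (Num.max 0 (M - N + 1)))].

Lemma window_uniq N M : uniq (window N M).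
Proof.
rewrite map_inj_in_uniq ?iota_uniq // => i j _ _ /addrI.
by case.
Qed.

Lemma mem_window N M i : N <= i -> i <= M -> i \in window N M.
Proof.
move=> Ni iM; apply/mapP; exists (absz (i - N)); last first.
  by rewrite gez0_abs ?subr_ge0 // [RHS]addrC subrK.
rewrite mem_iota /= add0n -ltz_nat !gez0_abs ?subr_ge0 ?le_max ?lexx //.
by rewrite lt_max ltzD1 lerD2r iM orbT.
Qed.

Lemma laurent_mul_bounded a b N M :
    (forall i, i < N -> a i = 0) -> (forall i, i < M -> b i = 0) ->
  forall n, n < N + M -> \sum_(i \in [set: int]) a i * b (n - i) = 0.
Proof.
move=> ha hb n nNM; rewrite (@fsum_seq _ [::]) ?big_nil // => i _.
case: (ltP i N) => [iN|Ni]; first by rewrite ha ?mul0r.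
by rewrite hb ?mulr0 // ltrBlDr (lt_le_trans nNM) // addrC lerD2l.
Qed.

Lemma laurent_mulE a b n :
  laurent_mul a b n = \sum_(i \in [set: int]) a i * b (n - i).
Proof.
rewrite laurent_ofE //.
case: (lcoef_bounded a) (lcoef_bounded b) => N hN [M hM].
by exists (N + M); apply: laurent_mul_bounded.
Qed.

Lemma laurent_mul_seq a b n (s : seq int) : uniq s ->
    (forall i, i \notin s -> a i * b (n - i) = 0) ->
  laurent_mul a b n = \sum_(i <- s) a i * b (n - i).
Proof. by move=> us hs; rewrite laurent_mulE (fsum_seq us). Qed.

Lemma laurent_mul0_out a b n N M L K i :
    (forall i, i < N -> a i = 0) -> (forall i, i < M -> b i = 0) ->
  L <= N -> n - M <= K -> i \notin window L K -> a i * b (n - i) = 0.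
Proof.
move=> ha hb LN MK; apply: contraNeq => h; apply: mem_window.
  by apply: le_trans LN _; rewrite leNgt; apply: contra_neqN h => /ha ->; rewrite mul0r.
apply: le_trans MK; rewrite leNgt; apply: contra_neqN h => h.
by rewrite (hb (n - i)) ?mulr0 // ltrBlDr addrC -ltrBlDr.
Qed.

Lemma laurent_mulC : commutative laurent_mul.
Proof.
move=> a b; apply: laurentP => n.
case: (lcoef_bounded a) (lcoef_bounded b) => N hN [M hM].
have us : uniq [seq n - i | i <- window N (n - M)].
  by rewrite map_inj_uniq ?window_uniq // => i j /addrI /oppr_inj.
rewrite (@laurent_mul_seq a b n _ (window_uniq N (n - M))); last first.
  by move=> i; exact: (laurent_mul0_out hN hM).
rewrite (@laurent_mul_seq b a n _ us).
  by rewrite [RHS]big_map; apply: eq_bigr => i _; rewrite mulrC subKr.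
move=> i hi; rewrite mulrC -{2}[i](subKr n).
apply: (laurent_mul0_out hN hM (lexx N) (lexx _)).
apply: contra hi => hi; apply/mapP; exists (n - i) => //.
by rewrite subKr.
Qed.

Lemma laurent_mulA : associative laurent_mul.
Proof.
move=> a b c; apply: laurentP => n.
case: (lcoef_bounded a) (lcoef_bounded b) (lcoef_bounded c) => N hN [M hM] [P hP].
have hMP k : k < M + P -> laurent_mul b c k = 0.
  by rewrite laurent_mulE; exact: laurent_mul_bounded.
have hNM k : k < N + M -> laurent_mul a b k = 0.
  by rewrite laurent_mulE; exact: laurent_mul_bounded.
pose J := window N (n - (M + P)); pose I := window (N + M) (n - P).
rewrite (@laurent_mul_seq a _ n _ (window_uniq N (n - (M + P)))); last first.
  by move=> i; exact: (laurent_mul0_out hN hMP).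
rewrite (@laurent_mul_seq _ c n _ (window_uniq (N + M) (n - P))); last first.
  by move=> i; exact: (laurent_mul0_out hNM hP).
rewrite -/I -/J.
transitivity (\sum_(i <- I) \sum_(j <- J) a j * b (i - j) * c (n - i)).
  rewrite exchange_big /= [LHS]big_seq [RHS]big_seq; apply: eq_bigr => j jJ.
  have us : uniq [seq i - j | i <- I].
    by rewrite map_inj_uniq ?window_uniq // => i k /addIr.
  rewrite (@laurent_mul_seq b c (n - j) _ us).
    rewrite [X in _ * X]big_map mulr_sumr; apply: eq_bigr => i _.
    by rewrite mulrA opprB [n - j + _]addrA subrK.
  move=> i; apply: contraNeq => h; apply/mapP; exists (i + j); last by rewrite addrK.
  have Nj : N <= j.
    by case/mapP: jJ => k _ ->; rewrite lerDl.
  apply: mem_window.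
    rewrite addrC lerD // leNgt; apply: contra_neqN h => /hM ->.
    by rewrite mul0r.
  rewrite leNgt; apply: contra_neqN h => h; rewrite (hP (n - j - i)) ?mulr0 //.
  by rewrite -addrA -opprD ltrBlDr [P + _]addrC -ltrBlDr [j + i]addrC.
rewrite [LHS]big_seq [RHS]big_seq; apply: eq_bigr => i iI.
rewrite -big_distrl /=.
case: (ltP (n - i) P) => [/hP ->|Pi]; first by rewrite !mulr0.
congr (_ * _); rewrite (@laurent_mul_seq a b i _ (window_uniq N (n - (M + P)))) //.
move=> j; apply: (laurent_mul0_out hN hM (lexx N)).
by rewrite opprD addrCA addrC lerD2r lerBrDr addrC -lerBrDr.
Qed.

Lemma laurent_mul1 : left_id (laurent_const 1) laurent_mul.
Proof.
move=> a; apply: laurentP => n; rewrite (@laurent_mul_seq _ _ n [:: 0]) //.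
  by rewrite big_seq1 laurent_constE eqxx mul1r subr0.
by move=> i; rewrite inE laurent_constE => /negbTE ->; rewrite mul0r.
Qed.

Lemma laurent_mulDl : left_distributive laurent_mul +%R.
Proof.
move=> a b c; apply: laurentP => n; rewrite lcoefD.
case: (lcoef_bounded a) (lcoef_bounded b) (lcoef_bounded c) => N hN [M hM] [P hP].
have NML : Order.min N M <= N by rewrite ge_min lexx.
have NMR : Order.min N M <= M by rewrite ge_min lexx orbT.
pose s := window (Order.min N M) (n - P).
have us : uniq s := window_uniq _ _.
have ha i : i \notin s -> a i * c (n - i) = 0.
  exact: (laurent_mul0_out hN hP).
have hb i : i \notin s -> b i * c (n - i) = 0.
  exact: (laurent_mul0_out hM hP).
rewrite !(@laurent_mul_seq _ c n s) // -?big_split /=; last first.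
  by move=> i hi; rewrite lcoefD mulrDl ha ?hb ?addr0.
by apply: eq_bigr => i _; rewrite lcoefD mulrDl.
Qed.

Lemma laurent_1neq0 : laurent_const 1 != 0.
Proof.
apply/eqP => /(congr1 (fun a : {laurent R} => a 0)); rewrite laurent_constE eqxx.
by rewrite lcoef0 => /eqP; rewrite oner_eq0.
Qed.

HB.instance Definition _ := GRing.Zmodule_isComNzRing.Build {laurent R}
  laurent_mulA laurent_mulC laurent_mul1 laurent_mulDl laurent_1neq0.

Lemma lcoef1 n : (1 : {laurent R}) n = if n == 0 then 1 else 0.
Proof. exact: laurent_constE. Qed.

Lemma lcoefM a b n : (a * b) n = \sum_(i \in [set: int]) a i * b (n - i).
Proof. exact: laurent_mulE. Qed.

Definition laurent_unit : {pred {laurent R}} :=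
  fun a => `[< exists b, b * a = 1 >].

Definition laurent_inv a : {laurent R} :=
  if pselect (exists b, b * a = 1) is left h then projT1 (cid h) else a.

Lemma laurent_mulV : {in laurent_unit, left_inverse 1 laurent_inv *%R}.
Proof.
move=> a /asboolP ha; rewrite /laurent_inv; case: pselect => // h.
by case: cid.
Qed.

Lemma laurent_unitPl a b : b * a = 1 -> laurent_unit a.
Proof. by move=> h; apply/asboolP; exists b. Qed.

Lemma laurent_inv_out : {in [predC laurent_unit], laurent_inv =1 id}.
Proof.
move=> a /asboolP ha; rewrite /laurent_inv.
by case: pselect.
Qed.

HB.instance Definition _ := GRing.ComNzRing_hasMulInverse.Build {laurent R}
  laurent_mulV laurent_unitPl laurent_inv_out.

(* The variable, written x or t. *)
Definition lX : {laurent R} := laurent_of (fun n => if n == 1 then 1 else 0).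

Lemma lcoefX n : lX n = if n == 1 then 1 else 0.
Proof.
rewrite laurent_ofE //; exists 1 => k; rewrite lt_neqAle => /andP[k1 _].
by rewrite (negbTE k1).
Qed.

Definition is_power_series a : Prop := forall n : int, n < 0 -> a n = 0.

Definition lderiv a : {laurent R} := laurent_of (fun n => (n + 1)%:~R * a (n + 1)).

Lemma lderivE a n : lderiv a n = (n + 1)%:~R * a (n + 1).
Proof.
rewrite laurent_ofE //; case: (lcoef_bounded a) => N hN.
by exists (N - 1) => k kN; rewrite hN ?mulr0 // -ltrBrDr.
Qed.

(* phi(f) = \sum_k phi_k f^k; the coefficientwise sums have finite support when
   f has positive order and either f is invertible or phi is a power series. *)
Definition lsubst (phi f : {laurent R}) : {laurent R} :=
  laurent_of (fun n => \sum_(k \in [set: int]) phi k * (f ^ k) n).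

(* Unconditional convergence of a family of series in the x-adic topology. *)
Definition lsums_to (I : eqType) (F : I -> {laurent R}) (G : {laurent R}) : Prop :=
  forall m : int, exists s : seq I, forall s' : seq I,
    uniq s' -> {subset s <= s'} ->
    forall n : int, n <= m -> (\sum_(i <- s') F i) n = G n.

(* A series in t not involving x, seen as a series in t whose coefficients are
   Laurent series in x. *)
Definition llift a : {laurent {laurent R}} := laurent_of (fun n => laurent_const (a n)).

Lemma lliftE a n : llift a n = laurent_const (a n).
Proof.
rewrite laurent_ofE //; case: (lcoef_bounded a) => N hN.
exists N => k kN; rewrite hN //; apply: laurentP => m.
by rewrite laurent_constE lcoef0 if_same.
Qed.

End ComNzRing.

Arguments lX {R}.

(* Main.v *)
Require Import Defs.
From HB Require Import structures.
From mathcomp Require Import all_boot all_order all_algebra.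
From mathcomp Require Import boolp classical_sets cardinality fsbigop.
From mathcomp Require Import zify ring.

(** Write r for R(f), so that f = x r.

    The equation f = x R(f) is a fixed-point problem.  If g and h have order at
    least 1 and agree below degree n, then R(g) and R(h) agree below degree n,
    so x R(g) and x R(h) agree below degree n + 1.  The map g |-> x R(g) is
    therefore a contraction for the x-adic topology and has a unique fixed
    point ([contraction_fixpoint], [functional_equation]).  The inverse of a
    power series with invertible constant term is another such fixed point
    ([order_ge0_unit]).

    Suppose that R(0) is invertible.  Then f = x r with r(0) invertible, f is a
    unit, and h |-> h(f) is a ring morphism on Laurent series that satisfies the
    chain rule.  Everything rests on the invariance of residues under the change
    of variable t = f(x) ([residue_lsubst]):
      Res h(f) f' = Res h.
    For h = t^k with k <> -1 the left side is the residue of the derivative of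
    f^(k+1)/(k+1), hence 0; for k = -1 it is the residue of f'/f = 1/x + r'/r,
    hence 1.

    Differentiating f = x R(f) gives f' (1 - x R'(f)) = R(f).  With x = f/R(f),
    the coefficient of x^n in psi(f) / (1 - x R'(f)) becomes
      Res x^(-n-1) psi(f) f' / R(f) = Res (t^(-n-1) psi(t) R(t)^n)(f) f',
    which is the coefficient of t^n in psi R^n ([lagrange_psi]).  The other
    formulas follow: psi = (1 - t R'/R) phi gives the second one, because
    f R'(f)/R(f) = x R'(f); the derivative of phi R^n turns the second one into
    the first one; and the third one collects, for each power of x, the two
    terms that occur in the second one.

    If R(0) = 0 then f = 0, so phi(f) is the constant phi(0), and R has order at
    least 1.  Both sides of each formula are then explicit: phi R^n has order at
    least n, with coefficient phi(0) R_1^n in degree n.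

    Identities that are linear and continuous in a Laurent series are checked on
    monomials only ([laurent_functional_ext]). *)

Set Implicit Arguments.
Unset Strict Implicit.
Unset Printing Implicit Defensive.

Import Order.TTheory GRing.Theory Num.Theory.
Local Open Scope ring_scope.

(** * Orders and coefficients *)

Definition order_ge (A : nmodType) (N : int) (a : {laurent A}) : Prop :=
  forall n : int, n < N -> a n = 0.

Lemma sum_delta (V : nmodType) (I : eqType) (s : seq I) (u : I -> V) j : uniq s ->
  \sum_(i <- s) (if i == j then u i else 0) = if j \in s then u j else 0.
Proof.
move=> us; case: ifPn => js.
  rewrite (bigD1_seq j) //= eqxx big1 ?addr0 //.
  by move=> i /negbTE->.
by rewrite big1_seq // => i /= si; case: eqP => // E; rewrite -E si in js.
Qed.

Section Coefficients.
Variable C : comNzRingType.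
Implicit Types (a b : {laurent C}) (c : C) (N M n k : int).

Lemma lcoefB a b n : (a - b) n = a n - b n.
Proof. by rewrite lcoefD lcoefN. Qed.

Lemma lcoef_sum (I : Type) (s : seq I) (F : I -> {laurent C}) n :
  (\sum_(i <- s) F i) n = \sum_(i <- s) F i n.
Proof. by elim/big_rec2: _ => // i x y _ <-; rewrite lcoefD. Qed.

Lemma order_exists a : exists N, order_ge N a.
Proof. exact: lcoef_bounded. Qed.

Lemma order_ge_le N M a : M <= N -> order_ge N a -> order_ge M a.
Proof. by move=> MN ha n nM; apply: ha; lia. Qed.

Lemma order_ge0 N : order_ge N (0 : {laurent C}).
Proof. by []. Qed.

Lemma order_geD N a b : order_ge N a -> order_ge N b -> order_ge N (a + b).
Proof. by move=> ha hb n nN; rewrite lcoefD ha ?hb ?addr0. Qed.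

Lemma order_geN N a : order_ge N a -> order_ge N (- a).
Proof. by move=> ha n nN; rewrite lcoefN ha ?oppr0. Qed.

Lemma order_geB N a b : order_ge N a -> order_ge N b -> order_ge N (a - b).
Proof. by move=> ha hb; apply: order_geD => //; apply: order_geN. Qed.

Lemma order_ge_sum N (I : Type) (s : seq I) (F : I -> {laurent C}) :
  (forall i, order_ge N (F i)) -> order_ge N (\sum_(i <- s) F i).
Proof. by move=> hF n nN; rewrite lcoef_sum big1 // => i _; apply: hF. Qed.

Lemma order_geM N M a b :
  order_ge N a -> order_ge M b -> order_ge (N + M) (a * b).
Proof.
by move=> ha hb n nNM; rewrite lcoefM; apply: laurent_mul_bounded nNM.
Qed.

Lemma order_ge1 : order_ge 0 (1 : {laurent C}).
Proof. by move=> n n0; rewrite lcoef1 lt_eqF. Qed.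

Lemma order_geX N a (k : nat) : order_ge N a -> order_ge (N * k%:Z) (a ^+ k).
Proof.
move=> ha; elim: k => [|k IH]; first by rewrite mulr0 expr0; exact: order_ge1.
rewrite exprS; have -> : N * k.+1%:Z = N + N * k%:Z by lia.
exact: order_geM.
Qed.

Lemma lcoefM_bot N M a b :
  order_ge N a -> order_ge M b -> (a * b) (N + M) = a N * b M.
Proof.
move=> ha hb; rewrite [LHS](@laurent_mul_seq _ a b _ [:: N]) // => [|i].
  by rewrite big_seq1; congr (_ * b _); lia.
rewrite inE => iN; have [/ha->|Ni] := ltP i N; first by rewrite mul0r.
by rewrite hb ?mulr0 //; lia.
Qed.

Lemma lcoefX_bot N a (k : nat) : order_ge N a -> (a ^+ k) (N * k%:Z) = a N ^+ k.
Proof.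
move=> ha; elim: k => [|k IH]; first by rewrite mulr0 !expr0 lcoef1 eqxx.
rewrite !exprS -IH -lcoefM_bot //; first by congr (lcoef _ _); lia.
exact: order_geX.
Qed.

Lemma lcoef_constM c a n : (laurent_const c * a) n = c * a n.
Proof.
rewrite [LHS](@laurent_mul_seq _ _ _ _ [:: 0]) // => [|i].
  by rewrite big_seq1 laurent_constE eqxx subr0.
by rewrite inE laurent_constE => /negbTE->; rewrite mul0r.
Qed.

Lemma order_ge_const c : order_ge 0 (laurent_const c).
Proof. by move=> n n0; rewrite laurent_constE lt_eqF. Qed.

Lemma laurent_const_is_additive : zmod_morphism (@laurent_const C).
Proof.
move=> c d; apply: laurentP => n; rewrite lcoefB !laurent_constE.
by case: ifP; rewrite ?subr0.
Qed.

Lemma laurent_const_is_multiplicative : monoid_morphism (@laurent_const C).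
Proof.
split=> // c d; apply: laurentP => n; rewrite lcoef_constM !laurent_constE.
by case: ifP; rewrite ?mulr0.
Qed.

HB.instance Definition _ := GRing.isZmodMorphism.Build C {laurent C}
  (@laurent_const C) laurent_const_is_additive.
HB.instance Definition _ := GRing.isMonoidMorphism.Build C {laurent C}
  (@laurent_const C) laurent_const_is_multiplicative.

Lemma lcoef_XM a n : (lX * a) n = a (n - 1).
Proof.
rewrite [LHS](@laurent_mul_seq _ _ _ _ [:: 1]) // => [|i].
  by rewrite big_seq1 lcoefX eqxx mul1r.
by rewrite inE lcoefX => /negbTE->; rewrite mul0r.
Qed.

Lemma order_ge_lX : order_ge 1 (lX : {laurent C}).
Proof. by move=> n n1; rewrite lcoefX lt_eqF. Qed.

Lemma lX_unit : (lX : {laurent C}) \is a GRing.unit.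
Proof.
have bd : bounded_below (fun n : int => if n == -1 then 1 else 0 : C).
  by exists (-1) => n n1; rewrite lt_eqF.
apply/asboolP; exists (laurent_of (fun n : int => if n == -1 then 1 else 0)).
apply: laurentP => n; rewrite mulrC lcoef_XM laurent_ofE // lcoef1.
by congr (if _ then _ else _); lia.
Qed.

Lemma lcoef_XzM k a n : (lX ^ k * a) n = a (n - k).
Proof.
elim: k a n => [|k IH|k IH] a n; first by rewrite expr0z mul1r subr0.
  by rewrite exprSz -mulrA lcoef_XM IH; congr (lcoef _ _); lia.
have -> : lX ^ (- k.+1%:Z) * a = lX ^ (- k%:Z) * (lX ^ (-1) * a).
  by rewrite mulrA -exprzDr ?lX_unit //; congr (lX ^ _ * _); lia.
have -> : a (n - - k.+1%:Z) = (lX * (lX^-1 * a)) (n - - k.+1%:Z).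
  by rewrite mulVKr ?lX_unit.
by rewrite IH lcoef_XM; congr (lcoef _ _); lia.
Qed.

Lemma lcoef_Xz k n : (lX ^ k : {laurent C}) n = if n == k then 1 else 0.
Proof. by rewrite -[lX ^ k]mulr1 lcoef_XzM lcoef1 subr_eq0. Qed.

Lemma lcoef_mono c k n : (laurent_const c * lX ^ k) n = if n == k then c else 0.
Proof. by rewrite lcoef_constM lcoef_Xz; case: ifP; rewrite ?mulr1 ?mulr0. Qed.

Lemma lcoef_monoM c k a n : (laurent_const c * lX ^ k * a) n = c * a (n - k).
Proof. by rewrite -mulrA lcoef_constM lcoef_XzM. Qed.

Lemma order_ge_Xz k : order_ge k (lX ^ k : {laurent C}).
Proof. by move=> n nk; rewrite lcoef_Xz lt_eqF. Qed.

Lemma order_ge_XM N a : order_ge N a -> order_ge (N + 1) (lX * a).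
Proof. by move=> ha; rewrite addrC; apply: order_geM => //; apply: order_ge_lX. Qed.

(** The density principle behind every identity below: modulo high order a
    Laurent series is a finite sum of monomials, so an additive map that kills
    high order and all monomials is zero.  A coefficient of the difference of two
    sides of an identity is such a map. *)
Lemma laurent_functional_ext (V : zmodType) (D : {laurent C} -> V) :
    {morph D : a b / a + b} ->
    (exists M, forall a, order_ge M a -> D a = 0) ->
    (forall c k, D (laurent_const c * lX ^ k) = 0) ->
  forall a, D a = 0.
Proof.
move=> DD [M hM] Dm a; have [N ha] := order_exists a.
have D0 : D 0 = 0 by apply: (addrI (D 0)); rewrite -DD !addr0.
pose s := window N M; pose p := \sum_(i <- s) laurent_const (a i) * lX ^ i.
have Dp : D p = 0 by rewrite (big_morph _ DD D0) big1.
rewrite -(subrK p a) DD Dp addr0; apply: hM => n nM; rewrite lcoefB.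
have -> : p n = if n \in s then a n else 0.
  rewrite lcoef_sum -(sum_delta _ _ (window_uniq N M)).
  by apply: eq_bigr => i _; rewrite lcoef_mono eq_sym.
case: ifPn => [|ns]; first by rewrite subrr.
rewrite subr0 ha // ltNge; apply: contra ns => Nn.
by apply: mem_window => //; apply: ltW.
Qed.

End Coefficients.

(** * Fixed points of contractions, and units *)

Section FixedPoints.
Variable C : comNzRingType.
Implicit Types (a b f g : {laurent C}) (n d : int).

Lemma laurent_eq_order d a b :
  (forall k : nat, order_ge (d + k%:Z) (a - b)) -> a = b.
Proof.
move=> h; apply: laurentP => n; apply/eqP; rewrite -subr_eq0 -lcoefB.
by apply/eqP/(h (absz (n - d)).+1); lia.
Qed.

(** Each application of [T] makes one more coefficient of the iterates of 0
    final, so the coefficients of the fixed point are read off the iterates; the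
    same estimate forces two fixed points to agree in every degree. *)
Lemma contraction_fixpoint d (T : {laurent C} -> {laurent C}) :
    (forall a, order_ge d a -> order_ge d (T a)) ->
    (forall n a b, order_ge d a -> order_ge d b -> order_ge n (a - b) ->
       order_ge (n + 1) (T a - T b)) ->
  exists f, unique (fun g => order_ge d g /\ g = T g) f.
Proof.
move=> Td Tc; pose u (k : nat) := iter k T 0.
have ud k : order_ge d (u k).
  by elim: k => [|k IH]; [exact: order_ge0 | exact: Td].
have uS k : order_ge (d + k%:Z) (u k.+1 - u k).
  elim: k => [|k IH]; first by rewrite addr0; apply: order_geB.
  rewrite (_ : d + k.+1%:Z = d + k%:Z + 1); last lia.
  exact: (Tc _ _ _ (ud _) (ud _) IH).
have uD k j : order_ge (d + k%:Z) (u (k + j)%N - u k).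
  elim: j => [|j IH]; first by rewrite addn0 subrr.
  have -> : u (k + j.+1)%N - u k =
      (u (k + j).+1 - u (k + j)%N) + (u (k + j)%N - u k).
    by rewrite addrA subrK addnS.
  by apply: order_geD => //; apply: order_ge_le (uS _); lia.
(* The coefficient in degree n = d + m is final from the iterate m + 1 on. *)
pose v n := u (absz (n - d)).+1 n.
have vd n : n < d -> v n = 0 by move=> nd; apply: ud.
pose f := laurent_of v.
have fE n : f n = v n by rewrite laurent_ofE //; exists d.
have fd : order_ge d f by move=> n nd; rewrite fE vd.
have fu k : order_ge (d + k%:Z) (f - u k).
  move=> n nk; rewrite lcoefB fE; have [nd|dn] := ltP n d.
    by rewrite vd // ud // subrr.
  have -> : u k = u ((absz (n - d)).+1 + (k - (absz (n - d)).+1))%N.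
    by congr u; lia.
  rewrite -[LHS]opprK opprB -lcoefB (uD (absz (n - d)).+1) ?oppr0 //; lia.
have fT : f = T f.
  apply: (@laurent_eq_order d) => k.
  have -> : f - T f = (f - u k.+1) - (T f - u k.+1).
    by rewrite opprB addrA subrK.
  apply: order_geB; first by apply: order_ge_le (fu k.+1); lia.
  by apply: order_ge_le (Tc _ _ _ fd (ud k) (fu k)); lia.
exists f; split=> // g [gd gT].
apply: (@laurent_eq_order d); elim=> [|k IH]; first by rewrite addr0; apply: order_geB.
rewrite (_ : d + k.+1%:Z = d + k%:Z + 1); last lia.
by rewrite fT gT; apply: Tc.
Qed.

End FixedPoints.

Section Units.
Variable C : comUnitRingType.
Implicit Types (a : {laurent C}) (k : int).

(** Writing a = a_0 + e with e of order at least 1, the inverse b solves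
    b = a_0^-1 (1 - e b), which is a contraction. *)
Lemma order_ge0_unit a : order_ge 0 a -> a 0 \is a GRing.unit ->
  a \is a GRing.unit /\ order_ge 0 a^-1.
Proof.
move=> a_ge0 a0; pose e := a - laurent_const (a 0).
have e_ge1 : order_ge 1 e.
  move=> n n1; rewrite lcoefB laurent_constE; case: eqP => [->|n0].
    by rewrite subrr.
  by rewrite subr0 a_ge0 //; lia.
pose T b := laurent_const (a 0)^-1 * (1 - e * b).
have [b [[b_ge0 bT] _]] : exists b, unique (fun b => order_ge 0 b /\ b = T b) b.
  apply: contraction_fixpoint => [b hb|n b c hb hc hbc].
    rewrite -[0]addr0; apply: order_geM; first exact: order_ge_const.
    apply: order_geB; first exact: order_ge1.
    by apply: (@order_ge_le _ (1 + 0)) => //; apply: order_geM.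
  have -> : T b - T c = - laurent_const (a 0)^-1 * (e * (b - c)).
    by rewrite /T; ring.
  rewrite -[n + 1]add0r [n + 1]addrC; apply: order_geM; last exact: order_geM.
  by apply: order_geN; apply: order_ge_const.
have ba : b * a = 1.
  have -> : a = laurent_const (a 0) + e by rewrite addrC subrK.
  rewrite mulrDr {1}bT /T mulrC mulrA -rmorphM divrr // rmorph1 mul1r.
  by rewrite [b * e]mulrC subrK.
have ua : a \is a GRing.unit by apply/unitrPr; exists b; rewrite mulrC.
by split=> //; rewrite -(mulr1_eq ba) // invrK.
Qed.

Lemma order_ge0_exprz a k : order_ge 0 a -> a 0 \is a GRing.unit ->
  order_ge 0 (a ^ k).
Proof.
move=> a_ge0 a0; case: k => k.
  by rewrite -exprnP -[0](mul0r k%:Z); apply: order_geX.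
have [_ aV] := order_ge0_unit a_ge0 a0.
by rewrite NegzE -exprz_inv -exprnP -[0](mul0r k.+1%:Z); apply: order_geX.
Qed.

End Units.

(** * Derivatives *)

Section Derivative.
Variable C : comNzRingType.
Implicit Types (a b : {laurent C}) (c : C) (k n : int).

Lemma lderivD a b : lderiv (a + b) = lderiv a + lderiv b.
Proof. by apply: laurentP => n; rewrite lcoefD !lderivE lcoefD mulrDr. Qed.

Lemma order_ge_lderiv n a : order_ge n a -> order_ge (n - 1) (lderiv a).
Proof. by move=> ha m mn; rewrite lderivE ha ?mulr0 //; lia. Qed.

Lemma lderiv_power_series a : is_power_series a -> is_power_series (lderiv a).
Proof.
move=> ha n n0; rewrite lderivE; have [->|n1] := eqVneq n (-1).
  by rewrite addNr mul0r.
by rewrite ha ?mulr0 //; lia.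
Qed.

Lemma lderiv_mono c k :
  lderiv (laurent_const c * lX ^ k) = laurent_const (k%:~R * c) * lX ^ (k - 1).
Proof.
apply: laurentP => n; rewrite lderivE !lcoef_constM !lcoef_Xz.
rewrite -[_ == _ - 1](inj_eq (addIr 1)) subrK.
by case: eqP => [->|_]; rewrite ?mulr0 ?mulr1.
Qed.

(** Both sides are linear and continuous in [a], and for a monomial [a] the rule
    is a comparison of coefficients. *)
Lemma lderivM a b : lderiv (a * b) = lderiv a * b + a * lderiv b.
Proof.
apply: laurentP => n; apply/eqP; rewrite -subr_eq0 -lcoefB; apply/eqP.
have [M hb] := order_exists b.
pose D a := (lderiv (a * b) - (lderiv a * b + a * lderiv b)) n.
apply: (@laurent_functional_ext _ _ D).
- by move=> x y; rewrite -lcoefD /D mulrDl !lderivD; congr (lcoef _ n); ring.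
- exists (n + 2 - M) => x hx.
  have h1 := order_ge_lderiv (order_geM hx hb).
  have h2 := order_geM (order_ge_lderiv hx) hb.
  have h3 := order_geM hx (order_ge_lderiv hb).
  by rewrite /D lcoefB lcoefD h1 ?h2 ?h3 ?addr0 ?subrr //; lia.
move=> c k; rewrite /D lderiv_mono lcoefB lcoefD lderivE.
rewrite !lcoef_monoM lderivE.
have -> : n - (k - 1) = n - k + 1 by lia.
have -> : n + 1 - k = n - k + 1 by lia.
have -> : n - k + 1 = n + 1 - k by lia.
by rewrite !rmorphB /= !rmorphD /=; ring.
Qed.

Lemma lderiv1 : lderiv (1 : {laurent C}) = 0.
Proof. by apply: (addrI (lderiv 1)); rewrite -{3}[1]mulr1 lderivM mulr1 mul1r addr0. Qed.

Lemma lderiv_const c : lderiv (laurent_const c) = 0.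
Proof.
have -> : laurent_const c = laurent_const c * lX ^ 0 by rewrite expr0z mulr1.
by rewrite lderiv_mono mul0r rmorph0 mul0r.
Qed.

Lemma lderivX : lderiv (lX : {laurent C}) = 1.
Proof.
have -> : lX = laurent_const 1 * lX ^ 1 :> {laurent C}.
  by rewrite rmorph1 mul1r expr1z.
by rewrite lderiv_mono mulr1 rmorph1 mul1r rmorph1.
Qed.

(** The product rule for u^(k+1) = u^k u relates the statements for k and k + 1
    in both directions, the descending one because [u] is a unit. *)
Lemma lderivXz u k : u \is a GRing.unit ->
  lderiv (u ^ k) = k%:~R * u ^ (k - 1) * lderiv u :> {laurent C}.
Proof.
move=> uu; have uS j : u ^ (j + 1) = u ^ j * u by rewrite exprzDr.
elim: k => [|k IH|k IH].
- by rewrite expr0z lderiv1 !mul0r.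
- have -> : k.+1%:Z - 1 = k%:Z - 1 + 1 by lia.
  have -> : k.+1%:Z = k%:Z + 1 by lia.
  rewrite uS lderivM IH uS.
  have -> : u ^ k = u ^ (k%:Z - 1) * u by rewrite -uS subrK.
  by rewrite rmorphD /=; ring.
apply: (mulIr uu); have := lderivM (u ^ (- k.+1%:Z)) u.
rewrite -uS; have -> : - k.+1%:Z + 1 = - k%:Z by lia.
rewrite IH; have -> : - k%:Z - 1 = - k.+1%:Z by lia.
have -> : - k.+1%:Z = - k.+1%:Z - 1 + 1 by lia.
have -> : - k.+1%:Z - 1 + 1 - 1 = - k.+1%:Z - 1 by lia.
rewrite uS => E.
apply: (addIr (u ^ (- k.+1%:Z - 1) * u * lderiv u)).
rewrite -{}E !rmorphD /= !rmorphN /=; have -> : k.+1%:Z = k%:Z + 1 by lia.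
by rewrite rmorphD /=; ring.
Qed.

End Derivative.

(** * Substitution *)

Section Substitution.
Variable C : comNzRingType.
Implicit Types (a b f g phi : {laurent C}) (c : C) (n : int).

Lemma lsubstE N phi f n : order_ge N phi ->
    (forall k, N <= k -> order_ge k (f ^ k)) ->
  lsubst phi f n = \sum_(k \in [set: int]) phi k * (f ^ k) n.
Proof.
move=> hphi hf; rewrite /lsubst laurent_ofE //; exists N => m mN.
rewrite (fsum_seq (s := [::])) ?big_nil // => k _.
by have [/hphi->|Nk] := ltP k N; rewrite ?mul0r // hf ?mulr0 //; lia.
Qed.

(** Since f^k has order at least k, only the finitely many k between the order of
    [phi] and n contribute to the coefficient of degree n. *)
Lemma lsubst_window N M phi f n : order_ge N phi ->
    (forall k, N <= k -> order_ge k (f ^ k)) -> n <= M ->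
  lsubst phi f n = \sum_(k <- window N M) phi k * (f ^ k) n.
Proof.
move=> hphi hf nM; rewrite (lsubstE _ hphi hf).
apply: fsum_seq (window_uniq _ _) _ => k.
have [/hphi->|Nk] := ltP k N; first by rewrite mul0r.
have [kM|Mk _] := leP k M; first by rewrite mem_window.
by rewrite hf ?mulr0 //; lia.
Qed.

Lemma order_ge_lsubst N phi f : order_ge N phi ->
  (forall k, N <= k -> order_ge k (f ^ k)) -> order_ge N (lsubst phi f).
Proof.
move=> hphi hf n nN; rewrite (lsubst_window hphi hf (lexx n)) big1_seq // => k /=.
case/mapP => j _ ->; rewrite hf ?mulr0 //; lia.
Qed.

(** In negative degrees every term of the defining sum vanishes, also when [f] has
    a nonzero constant term and the sums in other degrees may be infinite.  This
    is what gives every power series solution of f = x R(f) a zero constant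
    term. *)
Lemma lsubst_power_series phi f :
  is_power_series phi -> is_power_series f -> is_power_series (lsubst phi f).
Proof.
move=> hphi hf.
have z n : n < 0 -> \sum_(k \in [set: int]) phi k * (f ^ k) n = 0.
  move=> n0; rewrite (fsum_seq (s := [::])) ?big_nil // => -[] k _.
    by rewrite -exprnP (order_geX (k := k) hf) ?mulr0 ?mul0r.
  by rewrite hphi ?mul0r.
by move=> n n0; rewrite /lsubst laurent_ofE ?z //; exists 0.
Qed.

Lemma lsubst_at0 phi : is_power_series phi -> lsubst phi 0 = laurent_const (phi 0).
Proof.
move=> hphi; have h0 k : 0 <= k -> order_ge k ((0 : {laurent C}) ^ k).
  case: k => // k _; rewrite -exprnP expr0n; case: k => [|k] //.
  exact: order_ge1.
apply: laurentP => n; rewrite (lsubstE _ hphi h0) (fsum_seq (s := [:: 0])) //.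
  by rewrite big_seq1 expr0z lcoef1 laurent_constE; case: ifP; rewrite ?mulr1 ?mulr0.
move=> [k|k]; last by rewrite hphi ?mul0r.
by rewrite inE -exprnP expr0n => /negbTE; case: k => // k _; rewrite mulr0.
Qed.

Lemma order_ge1_exprz f k : order_ge 1 f -> 0 <= k -> order_ge k (f ^ k).
Proof. by case: k => // k hf _; rewrite -exprnP -[k%:Z]mul1r; apply: order_geX. Qed.

(** Because f - g divides f^k - g^k. *)
Lemma lsubst_congr n phi f g : is_power_series phi ->
    order_ge 1 f -> order_ge 1 g -> order_ge n (f - g) ->
  order_ge n (lsubst phi f - lsubst phi g).
Proof.
move=> hphi hf hg hfg m mn; rewrite lcoefB.
have E h : order_ge 1 h ->
    lsubst phi h m = \sum_(k <- window 0 m) phi k * (h ^ k) m.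
  by move=> hh; apply: lsubst_window => // k; apply: order_ge1_exprz.
rewrite [X in X - _](E f hf) [X in _ - X](E g hg) -sumrB big1_seq // => k _; rewrite -mulrBr.
case: k => k; last by rewrite hphi ?mul0r.
have f0 : order_ge 0 f by apply: order_ge_le hf.
have g0 : order_ge 0 g by apply: order_ge_le hg.
rewrite -lcoefB -!exprnP subrXX (order_geM hfg _ (M := 0)) ?mulr0 ?addr0 //.
apply: order_ge_sum => i; rewrite -[0]addr0.
by apply: order_geM; [rewrite -(mul0r (k.-1 - i)%N%:Z) | rewrite -(mul0r i%:Z)];
  apply: order_geX.
Qed.

(** The contraction lives on series of order at least 1; a power series solution
    g = x R(g) belongs there because R(g) is a power series. *)
Lemma functional_equation R : is_power_series R ->
  exists f, unique (fun g => is_power_series g /\ g = lX * lsubst R g) f.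
Proof.
move=> hR.
have [|n a b ha hb hab|f [[f1 fR] fu]] :=
  @contraction_fixpoint C 1 (fun g => lX * lsubst R g).
- move=> g g1; rewrite -[1]add0r; apply: order_ge_XM.
  by apply: lsubst_power_series => //; apply: order_ge_le g1.
- by rewrite -mulrBr; apply: order_ge_XM; apply: lsubst_congr.
exists f; split; first by split=> //; apply: order_ge_le f1.
move=> g [g0 gR]; apply: fu; split=> //.
by rewrite gR -[1]add0r; apply: order_ge_XM; apply: lsubst_power_series.
Qed.

Section Morphism.
Variable f : {laurent C}.
(* For k < 0 this bounds the pole of f^k; for a unit [f] it says that [f] has
   order exactly 1 with an invertible leading coefficient. *)
Hypothesis hf : forall k, order_ge k (f ^ k).
Hypothesis fu : f \is a GRing.unit.

Let hfN (N k : int) (_ : N <= k) := @hf k.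

Lemma lsubst_order N phi : order_ge N phi -> order_ge N (lsubst phi f).
Proof. by move=> hphi; apply: order_ge_lsubst. Qed.

Lemma lsubstD phi psi : lsubst (phi + psi) f = lsubst phi f + lsubst psi f.
Proof.
have [N hN] := order_exists phi; have [M hM] := order_exists psi.
have h1 : order_ge (Num.min N M) phi by apply: order_ge_le hN; rewrite ge_min lexx.
have h2 : order_ge (Num.min N M) psi by apply: order_ge_le hM; rewrite ge_min lexx orbT.
apply: laurentP => n; rewrite lcoefD.
rewrite !(lsubst_window _ (@hfN (Num.min N M)) (lexx n)) //; last exact: order_geD.
by rewrite -big_split /=; apply: eq_bigr => i _; rewrite lcoefD mulrDl.
Qed.

Lemma lsubst_mono c k : lsubst (laurent_const c * lX ^ k) f = laurent_const c * f ^ k.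
Proof.
have hk : order_ge k (laurent_const c * lX ^ k).
  by rewrite -[k in order_ge k]add0r; apply: order_geM; [apply: order_ge_const|apply: order_ge_Xz].
apply: laurentP => n; rewrite (lsubstE n hk (@hfN k)) (fsum_seq (s := [:: k])) //.
  by rewrite big_seq1 [RHS]lcoef_constM [X in X * _]lcoef_mono eqxx.
by move=> i; rewrite inE [X in X * _]lcoef_mono => /negbTE->; rewrite mul0r.
Qed.

(** By density in one factor and then in the other; for two monomials the claim
    is the law of exponents for the unit [f]. *)
Lemma lsubstM phi psi : lsubst (phi * psi) f = lsubst phi f * lsubst psi f.
Proof.
(* Additivity and continuity in the second factor serve both density steps. *)
have mulDD (u : {laurent C}) n :
  {morph (fun a => (lsubst (u * a) f - lsubst u f * lsubst a f) n) : a b / a + b}.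
  by move=> a b; rewrite -lcoefD mulrDr !lsubstD; congr (lcoef _ n); ring.
have mulO (u : {laurent C}) n : exists M, forall a, order_ge M a ->
    (lsubst (u * a) f - lsubst u f * lsubst a f) n = 0.
  have [N hu] := order_exists u; exists (n + 1 - N) => a ha.
  rewrite lcoefB (lsubst_order (order_geM hu ha)); last by lia.
  by rewrite (order_geM (lsubst_order hu) (lsubst_order ha)) ?subrr //; lia.
have monoM c k (a : {laurent C}) : lsubst (laurent_const c * lX ^ k * a) f =
    lsubst (laurent_const c * lX ^ k) f * lsubst a f.
  apply: laurentP => n; apply/eqP; rewrite -subr_eq0 -lcoefB; apply/eqP.
  move: a; apply: laurent_functional_ext => // d j.
  rewrite (_ : _ * _ = laurent_const (c * d) * lX ^ (k + j)).
    rewrite !lsubst_mono exprzDr // rmorphM /=.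
    by rewrite -(lcoef0 C n); congr (lcoef _ n); ring.
  by rewrite exprzDr ?lX_unit // rmorphM /=; ring.
apply: laurentP => n; apply/eqP; rewrite -subr_eq0 -lcoefB; apply/eqP.
move: psi; apply: laurent_functional_ext => // c k.
by rewrite mulrC monoM [X in X - _]mulrC subrr.
Qed.

Lemma lsubst_const c : lsubst (laurent_const c) f = laurent_const c.
Proof.
have {1}-> : laurent_const c = laurent_const c * lX ^ 0 by rewrite expr0z mulr1.
by rewrite lsubst_mono expr0z mulr1.
Qed.

Definition lsubst_at (a : {laurent C}) : {laurent C} := lsubst a f.

Lemma lsubst_zmod : zmod_morphism lsubst_at.
Proof.
move=> a b; apply: (addIr (lsubst b f)); rewrite subrK /lsubst_at -lsubstD.
by rewrite subrK.
Qed.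

Lemma lsubst_monoid : monoid_morphism lsubst_at.
Proof.
split; last exact: lsubstM.
by rewrite -(rmorph1 (@laurent_const C)); apply: lsubst_const.
Qed.

Definition lsubst_rmorphism : {rmorphism {laurent C} -> {laurent C}} :=
  HB.pack lsubst_at (GRing.isZmodMorphism.Build _ _ lsubst_at lsubst_zmod)
   (GRing.isMonoidMorphism.Build _ _ lsubst_at lsubst_monoid).

Lemma lsubstX : lsubst lX f = f.
Proof.
have -> : lX = laurent_const 1 * lX ^ 1 :> {laurent C}.
  by rewrite rmorph1 mul1r expr1z.
by rewrite lsubst_mono rmorph1 mul1r expr1z.
Qed.

(** By density, from the power rule for f^k. *)
Lemma chain_rule phi : lderiv (lsubst phi f) = lsubst (lderiv phi) f * lderiv f.
Proof.
apply: laurentP => n; apply/eqP; rewrite -subr_eq0 -lcoefB; apply/eqP.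
have f1 : order_ge 1 f by rewrite -[f]expr1z.
move: phi; apply: laurent_functional_ext.
- by move=> a b; rewrite -lcoefD !(lsubstD, lderivD); congr (lcoef _ n); ring.
- exists (n + 2) => a ha; rewrite lcoefB.
  have h1 := order_ge_lderiv (lsubst_order ha).
  have h2 := order_geM (lsubst_order (order_ge_lderiv ha)) (order_ge_lderiv f1).
  by rewrite h1 ?h2 ?subrr //; lia.
move=> c k; rewrite lderiv_mono !lsubst_mono lderivM lderiv_const mul0r add0r.
rewrite lderivXz // rmorphM /= rmorph_int -(lcoef0 C n); congr (lcoef _ n); ring.
Qed.

End Morphism.
End Substitution.

(** * Series in t with coefficients in x *)

Section Lift.
Variable C : comNzRingType.
Implicit Types (a b : {laurent C}) (n : int).

Lemma llift_is_additive : zmod_morphism (@llift C).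
Proof.
by move=> a b; apply: laurentP => n; rewrite lcoefB !lliftE lcoefB rmorphB.
Qed.

Lemma order_ge_llift N a : order_ge N a -> order_ge N (llift a).
Proof. by move=> ha n nN; rewrite lliftE ha ?rmorph0. Qed.

Lemma llift_is_multiplicative : monoid_morphism (@llift C).
Proof.
split=> [|a b]; apply: laurentP => n.
  by rewrite lliftE !lcoef1; case: ifP; rewrite ?rmorph1 ?rmorph0.
have [[N ha] [M hb]] := (order_exists a, order_exists b).
have out (A : comNzRingType) (c d : {laurent A}) i : order_ge N c -> order_ge M d ->
    i \notin window N (n - M) -> c i * d (n - i) = 0.
  by move=> hc hd; apply: laurent_mul0_out hc hd _ _.
rewrite lliftE.
rewrite [X in laurent_const X](laurent_mul_seq (window_uniq N (n - M))); last first.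
  by move=> i; apply: out.
rewrite [RHS](laurent_mul_seq (window_uniq N (n - M))).
  by rewrite rmorph_sum; apply: eq_bigr => i _; rewrite rmorphM !lliftE.
by move=> i; apply: out; apply: order_ge_llift.
Qed.

HB.instance Definition _ := GRing.isZmodMorphism.Build {laurent C}
  {laurent {laurent C}} (@llift C) llift_is_additive.
HB.instance Definition _ := GRing.isMonoidMorphism.Build {laurent C}
  {laurent {laurent C}} (@llift C) llift_is_multiplicative.

(** The i-th summand is supported in the degrees e(i) and e(i) + 1, so only the
    two indices n and n - 1 contribute to the degree n.  The map [e] lets the
    family be indexed by all integers or by the naturals. *)
Lemma lsums_to_two_term (I : eqType) (e : I -> int) (e' : int -> I)
    (a b : int -> C) N (G : {laurent C}) :
    injective e ->
    (forall n, e (e' n) = n \/ n < N) ->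
    (forall n, n < N -> a n = 0) -> (forall n, n < N -> b n = 0) ->
    (forall n, G n = a n - b (n - 1)) ->
  lsums_to (fun i => lX ^ e i *
    (laurent_const (a (e i)) - lX * laurent_const (b (e i)))) G.
Proof.
move=> e_inj eK ha hb hG m; exists [seq e' i | i <- window N m] => s' us' ss' n nm.
have ues : uniq [seq e i | i <- s'] by rewrite map_inj_uniq.
have pick (u : int -> C) j : (forall k, k < N -> u k = 0) -> j <= m ->
    \sum_(i <- s') (if e i == j then u (e i) else 0) = u j.
  move=> hu jm; rewrite -(big_map e xpredT (fun i => if i == j then u i else 0)).
  rewrite sum_delta //; case: ifPn => // jes; rewrite hu // ltNge.
  apply: contra jes => Nj; apply/mapP; exists (e' j).
    by apply/ss'/map_f/mem_window.
  by case: (eK j) => [->//|]; rewrite ltNge Nj.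
rewrite lcoef_sum hG -(pick a n) // -(pick b (n - 1)) //; last by lia.
rewrite -sumrB; apply: eq_bigr => i _.
rewrite lcoef_XzM lcoefB lcoef_XM !laurent_constE.
have -> : (n - e i == 0) = (e i == n) by lia.
by have -> : (n - e i - 1 == 0) = (e i == n - 1) by lia.
Qed.

(** Expanding 1 - x R' splits the coefficient of t^n, a series in x, into two
    terms that do not involve x otherwise. *)
Lemma lagrange_summandE (phi R' Rn : {laurent C}) n :
  ((1 - laurent_const lX * llift R') * llift phi * llift Rn) n =
  laurent_const ((phi * Rn) n) - lX * laurent_const ((R' * phi * Rn) n).
Proof.
have -> : (1 - laurent_const lX * llift R') * llift phi * llift Rn =
    llift (phi * Rn) - laurent_const lX * llift (R' * phi * Rn).
  by rewrite !rmorphM /=; ring.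
by rewrite lcoefB lcoef_constM !lliftE.
Qed.

End Lift.

(** * Residues under a change of variable *)

Section Residue.
Variable C : idomainType.
Hypothesis int_unit : forall k : int, k != 0 -> (k%:~R : C) \is a GRing.unit.
Variable r : {laurent C}.
Hypothesis r_ge0 : order_ge 0 r.
Hypothesis r0_unit : r 0 \is a GRing.unit.

Lemma lXM_unit : lX * r \is a GRing.unit.
Proof. by rewrite unitrM lX_unit; case: (order_ge0_unit r_ge0 r0_unit). Qed.

Lemma lXM_exprz k : (lX * r) ^ k = lX ^ k * r ^ k.
Proof.
have [r_unit _] := order_ge0_unit r_ge0 r0_unit.
by rewrite exprMz_comm ?lX_unit //; apply: mulrC.
Qed.

Lemma order_ge_lXM_exprz k : order_ge k ((lX * r) ^ k).
Proof.
rewrite lXM_exprz -[k in order_ge k]addr0; apply: order_geM.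
  exact: order_ge_Xz.
exact: order_ge0_exprz.
Qed.

(** For k <> -1 the series is a derivative up to the invertible factor k + 1;
    for k = -1 it is the logarithmic derivative 1/x + r'/r of x r. *)
Lemma residue_exprz k :
  ((lX * r) ^ k * lderiv (lX * r)) (-1) = if k == -1 then 1 else 0.
Proof.
have [r_unit rV] := order_ge0_unit r_ge0 r0_unit.
case: eqP => [->|/eqP k1].
  have -> : (lX * r) ^ (-1) * lderiv (lX * r) = lX ^ (-1) + r^-1 * lderiv r.
    have gen (u v x s t : {laurent C}) : u * x = 1 -> v * s = 1 ->
        u * v * (s + x * t) = u + v * t.
      move=> ux vs; transitivity (u * (v * s) + u * x * (v * t)); first by ring.
      by rewrite ux vs mulr1 mul1r.
    rewrite lXM_exprz lderivM lderivX mul1r; apply: gen; apply: mulVr => //.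
    exact: lX_unit.
  rewrite lcoefD lcoef_Xz eqxx (order_geM rV (lderiv_power_series r_ge0)) //.
  exact: addr0.
have k1_unit : ((k + 1)%:~R : C) \is a GRing.unit by apply: int_unit; lia.
apply: (mulrI k1_unit); rewrite mulr0 -lcoef_constM rmorph_int mulrA.
by rewrite -{2}[k](addrK 1) -lderivXz ?lXM_unit // lderivE addNr mul0r.
Qed.

(** By density from the powers of the new variable; series of nonnegative order
    have residue 0 on both sides. *)
Lemma residue_lsubst h :
  (lsubst h (lX * r) * lderiv (lX * r)) (-1) = h (-1).
Proof.
have hf := order_ge_lXM_exprz; have fu := lXM_unit.
apply/eqP; rewrite -subr_eq0; apply/eqP; move: h.
apply: laurent_functional_ext => [a b||c k].
- by rewrite (lsubstD hf) mulrDl !lcoefD; ring.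
- exists 0 => a ha; rewrite ha // subr0.
  have f1 : order_ge 0 (lX * r) by rewrite -[0]addr0; apply: order_geM r_ge0;
    apply: order_ge_le (order_ge_lX _).
  by rewrite (order_geM (lsubst_order hf ha) (lderiv_power_series f1)).
rewrite (lsubst_mono hf) lcoef_mono -mulrA [X in X - _]lcoef_constM residue_exprz.
by rewrite eq_sym; case: ifP; rewrite ?mulr1 ?mulr0 subrr.
Qed.

End Residue.

(** * Identities that do not involve the solution *)

Section Kernel.
Variable C : comUnitRingType.
Implicit Types (phi R : {laurent C}) (n : int).

Lemma lagrange_kernelE phi R n : R \is a GRing.unit ->
  ((1 - lX * lderiv R / R) * phi * R ^ n) n =
  (phi * R ^ n) n - (lderiv R * phi * R ^ (n - 1)) (n - 1).
Proof.
move=> uR.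
have gen (v s x d p q : {laurent C}) : v * s = 1 ->
    (1 - x * d * v) * p * (q * s) = p * (q * s) - x * (d * p * q).
  move=> vs; transitivity (p * (q * s) - x * (d * p * q) * (v * s)); first by ring.
  by rewrite vs mulr1.
have RnE : R ^ n = R ^ (n - 1) * R by rewrite -{3}[R]expr1z -exprzDr ?subrK.
by rewrite RnE gen ?mulVr // lcoefB lcoef_XM.
Qed.

(** The coefficient of t^(n-1) in the derivative of phi R^n, computed in two
    ways. *)
Lemma lagrange_derivE phi R n : R \is a GRing.unit ->
  (lderiv phi * R ^ n) (n - 1) =
  n%:~R * ((phi * R ^ n) n - (lderiv R * phi * R ^ (n - 1)) (n - 1)).
Proof.
move=> uR; have := lderivE (phi * R ^ n) (n - 1); rewrite subrK mulrBr => <-.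
rewrite lderivM (lderivXz n uR) -lcoef_constM rmorph_int -lcoefB.
by congr (lcoef _ _); ring.
Qed.

Lemma lcoefMX_bot phi R (k : nat) : is_power_series phi -> order_ge 1 R ->
  (phi * R ^+ k) k = phi 0 * R 1 ^+ k.
Proof.
move=> hphi hR; rewrite -(lcoefX_bot k hR) -lcoefM_bot //.
  by rewrite add0r mul1r.
exact: order_geX.
Qed.

(** From b = c + d x b for the quotient b. *)
Lemma geometric_lcoef c d (k : nat) :
  (laurent_const c / (1 - lX * laurent_const d)) k = c * d ^+ k :> C.
Proof.
pose u : {laurent C} := 1 - lX * laurent_const d.
have Xd : order_ge 1 (lX * laurent_const d : {laurent C}).
  by rewrite -[1]add0r; apply/order_ge_XM/order_ge_const.
have u_ge0 : order_ge 0 u.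
  by apply: order_geB; [exact: order_ge1 | exact: order_ge_le Xd].
have u0 : u 0 = 1 by rewrite lcoefB lcoef1 Xd // subr0.
have [uu uV] : u \is a GRing.unit /\ order_ge 0 u^-1.
  by apply: order_ge0_unit => //; rewrite u0 unitr1.
rewrite -/u; set b := laurent_const c / u.
have b_ge0 : order_ge 0 b by rewrite -[0]addr0; apply: order_geM => //; apply: order_ge_const.
have bE : b = laurent_const c + lX * (laurent_const d * b).
  have bu : b * u = laurent_const c by rewrite divrK.
  by rewrite -bu /u; ring.
elim: k => [|k IH]; rewrite bE lcoefD laurent_constE lcoef_XM lcoef_constM.
  by rewrite b_ge0 // mulr0 addr0 mulr1.
have -> : k.+1%:Z - 1 = k by lia.
by rewrite IH /= add0r exprS mulrCA.
Qed.

End Kernel.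

(** * Lagrange inversion when R(0) is invertible *)

Section Lagrange.
Variable C : idomainType.
Hypothesis int_unit : forall k : int, k != 0 -> (k%:~R : C) \is a GRing.unit.
Variables R f : {laurent C}.
Hypothesis hR : is_power_series R.
Hypothesis R0 : R 0 \is a GRing.unit.
Hypothesis f_ge0 : is_power_series f.
Hypothesis fE : f = lX * lsubst R f.

Let r := lsubst R f.

Let r_ge0 : order_ge 0 r.
Proof. exact: lsubst_power_series. Qed.

Lemma solution_order_ge1 : order_ge 1 f.
Proof. by rewrite fE -[1]add0r; apply: order_ge_XM; apply: r_ge0. Qed.

Let r0 : r 0 = R 0.
Proof.
rewrite /r (lsubst_window (N := 0) (M := 0)) //; last first.
  by move=> k; apply/order_ge1_exprz/solution_order_ge1.
by rewrite big_seq1 expr0z lcoef1 mulr1.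
Qed.

Let r0_unit : r 0 \is a GRing.unit. Proof. by rewrite r0. Qed.

Let R_unit : R \is a GRing.unit.
Proof. by case: (order_ge0_unit hR R0). Qed.

Let r_unit : r \is a GRing.unit.
Proof. by case: (order_ge0_unit r_ge0 r0_unit). Qed.

Lemma solution_unit : f \is a GRing.unit.
Proof. by rewrite fE; apply: lXM_unit. Qed.

Lemma order_ge_solution k : order_ge k (f ^ k).
Proof. by rewrite fE; apply: order_ge_lXM_exprz. Qed.

Let subM a b : lsubst (a * b) f = lsubst a f * lsubst b f.
Proof. exact: lsubstM order_ge_solution solution_unit a b. Qed.

Let sub := lsubst_rmorphism order_ge_solution solution_unit.

Let subXz a k : a \is a GRing.unit -> lsubst (a ^ k) f = lsubst a f ^ k.
Proof. by move=> ua; apply: (rmorphXz sub k ua). Qed.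

Let subX : lsubst lX f = f.
Proof. exact: lsubstX order_ge_solution. Qed.

Let J := 1 - lX * lsubst (lderiv R) f.

Let J_unit : J \is a GRing.unit.
Proof.
have h : order_ge 1 (lX * lsubst (lderiv R) f).
  rewrite -[1]add0r; apply: order_ge_XM; apply: lsubst_power_series => //.
  exact: lderiv_power_series.
suff [] : J \is a GRing.unit /\ order_ge 0 J^-1 by [].
apply: order_ge0_unit.
  by apply: order_geB; [exact: order_ge1 | exact: order_ge_le h].
by rewrite lcoefB lcoef1 h // subr0 unitr1.
Qed.

(** The derivative of f = x R(f). *)
Lemma lderiv_solution : lderiv f * J = r.
Proof.
have E : lderiv f = r + lX * (lsubst (lderiv R) f * lderiv f).
  rewrite {1}fE lderivM lderivX mul1r -/r.
  by rewrite (chain_rule order_ge_solution solution_unit).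
by rewrite /J mulrBr mulr1 {1}E; ring.
Qed.

(** The coefficient of x^n is the residue after multiplication by x^(-n-1).
    Substituting x = f/R(f) and 1 - x R'(f) = R(f)/f' turns the series into
    h(f) f' with h = t^(-n-1) psi R^n, whose residue is that of h. *)
Lemma lagrange_psi psi n : (lsubst psi f / J) n = (psi * R ^ n) n.
Proof.
pose h := lX ^ (- n - 1) * (psi * R ^ n).
have hE : h (-1) = (psi * R ^ n) n.
  by rewrite /h lcoef_XzM; congr (lcoef _ _); lia.
have cE : (lX ^ (- n - 1) * (lsubst psi f / J)) (-1) = (lsubst psi f / J) n.
  by rewrite lcoef_XzM; congr (lcoef _ _); lia.
rewrite -hE -cE -(residue_lsubst int_unit r_ge0 r0_unit h) -/r -fE.
congr (lcoef _ _).
have rK : lX ^ (- n - 1) = f ^ (- n - 1) * r ^ (n + 1).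
  have -> : f ^ (- n - 1) = lX ^ (- n - 1) * r ^ (- n - 1).
    by rewrite -(lXM_exprz r_ge0 r0_unit) -fE.
  have rV : r ^ (- n - 1) * r ^ (n + 1) = 1.
    rewrite -(exprzDr r_unit (- n - 1) (n + 1)).
    by have -> : - n - 1 + (n + 1) = 0 by lia; rewrite expr0z.
  have gen (a b c : {laurent C}) : b * c = 1 -> a = a * b * c.
    by move=> bc; rewrite -mulrA bc mulr1.
  exact: gen.
have subh : lsubst h f = f ^ (- n - 1) * (lsubst psi f * r ^ n).
  rewrite /h subM subXz ?lX_unit // subX; congr (_ * _).
  by rewrite subM subXz ?R_unit.
have rS : r ^ (n + 1) = r ^ n * (lderiv f * J).
  by rewrite (exprzDr r_unit n 1) expr1z lderiv_solution.
rewrite rK subh rS.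
have gen (v j p q s d : {laurent C}) : j * v = 1 ->
    p * (s * (d * j)) * (q * v) = p * (q * s) * d.
  move=> jv; transitivity (p * (q * s) * d * (j * v)); first by ring.
  by rewrite jv mulr1.
apply: gen; apply: mulrV J_unit.
Qed.

Lemma solution_ratio :
  f * lsubst (lderiv R) f / lsubst R f = lX * lsubst (lderiv R) f.
Proof.
have fr : f / r = lX by rewrite [X in X / _]fE; apply: mulrK r_unit _.
by rewrite mulrAC [X in X * _]fr.
Qed.

Lemma lsubst_kernel phi :
  lsubst ((1 - lX * lderiv R / R) * phi) f = lsubst phi f * J.
Proof.
have sR : lsubst (lX * lderiv R / R) f = f * lsubst (lderiv R) f / r.
  rewrite (subM (lX * lderiv R) R^-1) (subM lX (lderiv R)) subX.
  by congr (_ * _); apply: (rmorphV sub R_unit).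
have sB : lsubst (1 - lX * lderiv R / R) f = J.
  rewrite -[LHS]/(sub _) (rmorphB sub) (rmorph1 sub) /J -solution_ratio -sR.
  by [].
by rewrite subM sB mulrC.
Qed.

Lemma lagrange_kernel phi n :
  lsubst phi f n = ((1 - lX * lderiv R / R) * phi * R ^ n) n.
Proof. by rewrite -[RHS]lagrange_psi lsubst_kernel (mulrK J_unit). Qed.

Lemma lagrange_deriv phi n : n != 0 ->
  lsubst phi f n = (n%:~R)^-1 * (lderiv phi * R ^ n) (n - 1).
Proof.
move=> n0; rewrite [X in _ * X](lagrange_derivE phi n R_unit) (mulKr (int_unit n0)).
by rewrite [LHS]lagrange_kernel; apply: lagrange_kernelE R_unit.
Qed.

Lemma lagrange_psi_ratio psi n :
  (lsubst psi f / (1 - f * lsubst (lderiv R) f / lsubst R f)) n = (psi * R ^ n) n.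
Proof.
by rewrite solution_ratio; apply: lagrange_psi.
Qed.

Lemma lagrange_sum phi :
  lsums_to (fun n : int => lX ^ n *
    ((1 - laurent_const lX * llift (lderiv R)) * llift phi * llift R ^ n) n)
    (lsubst phi f).
Proof.
have [N hphi] := order_exists phi.
have RX n : order_ge 0 (R ^ n) by apply: order_ge0_exprz.
rewrite (_ : (fun n : int => _) = fun n => lX ^ id n *
  (laurent_const ((phi * R ^ id n) (id n)) -
   lX * laurent_const ((lderiv R * phi * R ^ id n) (id n)))).
  apply: (@lsums_to_two_term _ _ id id (fun n => (phi * R ^ n) n)
    (fun n => (lderiv R * phi * R ^ n) n) N) => //.
  - by move=> n; left.
  - by move=> n nN; rewrite (order_geM hphi (RX n)) // addr0.
  - move=> n nN; have R'0 := lderiv_power_series hR.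
    by rewrite (order_geM (order_geM R'0 hphi) (RX n)) //; lia.
  by move=> n; rewrite [LHS]lagrange_kernel; apply: lagrange_kernelE R_unit.
apply: funext => n; rewrite -lagrange_summandE.
by rewrite (rmorphXz (@llift C) n R_unit).
Qed.

End Lagrange.

(** * The case R(0) = 0 *)

Section Degenerate.
Variable C : comUnitRingType.
Variables R phi : {laurent C}.
Hypothesis hR : order_ge 1 R.
Hypothesis hphi : is_power_series phi.

Lemma degenerate_deriv (k : nat) : (lderiv phi * R ^+ k) (k%:Z - 1) = 0.
Proof.
rewrite (order_geM (lderiv_power_series hphi) (order_geX (k := k) hR)) //; lia.
Qed.

(** Both coefficients are leading ones, and both equal phi(0) R_1^(k+1). *)
Lemma degenerate_two_term (k : nat) :
  (phi * R ^+ k.+1) k.+1 - (lderiv R * phi * R ^+ k) k = 0.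
Proof.
have R'0 : is_power_series (lderiv R).
  by apply: lderiv_power_series; apply: order_ge_le hR.
have R'phi : order_ge 0 (lderiv R * phi) by rewrite -[0]addr0; apply: order_geM.
have E : (lderiv R * phi) 0 = lderiv R 0 * phi 0 by rewrite -lcoefM_bot.
rewrite (lcoefMX_bot k.+1 hphi hR) [X in _ - X](lcoefMX_bot k R'phi hR).
rewrite E lderivE add0r mul1r exprS.
by apply/eqP; rewrite subr_eq0; apply/eqP; ring.
Qed.

Lemma degenerate_sum :
  lsums_to (fun n : nat => lX ^+ n *
    ((1 - laurent_const lX * llift (lderiv R)) * llift phi * llift R ^+ n) n%:Z)
    (laurent_const (phi 0)).
Proof.
(* [R] need not be a unit, so the families are extended by 0 to n < 0. *)
pose u (p : {laurent C}) (n : int) := if n is Posz k then (p * R ^+ k) k else 0.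
rewrite (_ : (fun n : nat => _) = fun n => lX ^ n%:Z *
  (laurent_const (u phi n%:Z) - lX * laurent_const (u (lderiv R * phi) n%:Z))).
  apply: (@lsums_to_two_term _ _ Posz absz (u phi) (u (lderiv R * phi)) 0) => //.
  - by move=> m n [].
  - by case=> n; [left | right].
  - by case.
  - by case.
  case=> [[|k]|k]; rewrite laurent_constE.
  - by rewrite eqxx /= expr0 mulr1 subr0.
  - have -> : k.+1%:Z - 1 = k by lia.
    by rewrite -(degenerate_two_term k).
  have -> : Negz k - 1 = Negz k.+1 by lia.
  by rewrite /= subr0.
by apply: funext => n; rewrite -lagrange_summandE rmorphXn.
Qed.

End Degenerate.

(** * The Lagrange inversion formulas *)

Theorem theorem2p1p1 (C : idomainType) (iota : {rmorphism rat -> C})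
    (R : {laurent C}) (R_power_series : is_power_series R) :
  exists f : {laurent C},
    [/\ unique (fun g => is_power_series g /\ g = lX * lsubst R g) f,
      (* the constant term of R is invertible *)
      R 0 \is a GRing.unit ->
      forall phi psi : {laurent C},
        [/\ forall n : int, n != 0 ->
              lsubst phi f n = (n%:~R)^-1 * (lderiv phi * R ^ n) (n - 1),
            forall n : int,
              lsubst phi f n = ((1 - lX * lderiv R / R) * phi * R ^ n) n,
            lsums_to
              (fun n : int => lX ^ n *
                 ((1 - laurent_const lX * llift (lderiv R)) *
                  llift phi * llift R ^ n) n)
              (lsubst phi f),
            forall n : int,
              (lsubst psi f / (1 - lX * lsubst (lderiv R) f)) n =
              (psi * R ^ n) n
          & forall n : int,
              (lsubst psi f / (1 - f * lsubst (lderiv R) f / lsubst R f)) n =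
              (psi * R ^ n) n]
    & (* the constant term of R is zero: the formulas that make sense *)
      R 0 = 0 ->
      forall phi psi : {laurent C}, is_power_series phi -> is_power_series psi ->
        [/\ forall n : nat, n != 0%N ->
              lsubst phi f n%:Z =
              (n%:R)^-1 * (lderiv phi * R ^+ n) (n%:Z - 1),
            R \is a GRing.unit -> forall n : nat, n != 0%N ->
              lsubst phi f n%:Z =
              ((1 - lX * lderiv R / R) * phi * R ^+ n) n%:Z,
            lsums_to
              (fun n : nat => lX ^+ n *
                 ((1 - laurent_const lX * llift (lderiv R)) *
                  llift phi * llift R ^+ n) n%:Z)
              (lsubst phi f)
          & forall n : nat,
              (lsubst psi f / (1 - lX * lsubst (lderiv R) f)) n%:Z =
              (psi * R ^+ n) n%:Z]].
Proof.
have int_unit (k : int) : k != 0 -> (k%:~R : C) \is a GRing.unit.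
  by move=> k0; rewrite -(rmorph_int iota) rmorph_unit // unitfE intr_eq0.
have [f [[f_ge0 fE] fu]] := functional_equation R_power_series.
exists f; split=> [|R0 phi psi|R0 phi psi hphi hpsi].
- by split.
- split.
  + exact: lagrange_deriv.
  + exact: lagrange_kernel.
  + exact: lagrange_sum.
  + exact: lagrange_psi.
  exact: lagrange_psi_ratio.
have hR : order_ge 1 R.
  move=> n n1; have [->//|n0] := eqVneq n 0.
  by apply: R_power_series; lia.
have f0 : f = 0.
  apply: fu; split; first exact: order_ge0.
  by rewrite (lsubst_at0 R_power_series) R0 rmorph0 mulr0.
have R'0 := lderiv_power_series R_power_series.
rewrite f0 (lsubst_at0 hphi) (lsubst_at0 hpsi) (lsubst_at0 R'0).
split=> [n n0|uR n n0||n].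
- by rewrite degenerate_deriv // mulr0 laurent_constE; case: n n0.
- case: n n0 => // k _.
  rewrite exprnP (lagrange_kernelE _ _ uR) laurent_constE.
  have -> : k.+1%:Z - 1 = k by lia.
  by rewrite -!exprnP degenerate_two_term.
- exact: degenerate_sum.
by rewrite geometric_lcoef lcoefMX_bot // lderivE add0r mul1r.
Qed.
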